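(* Let $n,m\in\mathbb{N}$, let $\Omega\subset\mathbb{R}^n$ be a bounded domain containing the origin in its interior, let $Q\subset\mathbb{R}^m$ be an origin-symmetric convex body (containing the origin in its interior), and let $1\le p<\infty$. Then there exists a constant $C=C(n,m,p,Q,\Omega)>0$ such that, for every $f\in W^{1,p}_0(\Omega)$, $$\mathcal{E}_p(Q,f)\ge C\,\|f\|_{L^p(\mathbb{R}^n)}.$$
   Context: $\mathbb{R}^{nm}$ is identified with real $n\times m$ matrices: $x=(x_1,\dots,x_m)$ with $x_i\in\mathbb{R}^n$, and for $v\in\mathbb{R}^n$, $v^tx=(v^tx_1,\dots,v^tx_m)\in\mathbb{R}^m$. $\mathbb{S}^{d-1}$ and $B_2^d$ are the centered unit sphere and ball of $\mathbb{R}^d$, $\mathrm{vol}_d$ is Lebesgue measure, $\omega_n=\mathrm{vol}_n(B_2^n)$, and $dv,d\theta$ on spheres denote surface measure. A convex body is a compact convex set with non-empty interior; its support function is $h_Q(x)=\max_{y\in Q}y^tx$. For an origin-symmetric convex body $Q\subset\mathbb{R}^m$ (containing the origin in its interior) and $p\ge1$, $\Pi_{Q,p}B_2^n$ is the convex body in $\mathbb{R}^{nm}$ (it contains the origin in its interior) with $h_{\Pi_{Q,p}B_2^n}(\theta)^p=\int_{\mathbb{S}^{n-1}}h_Q(v^t\theta)^p\,dv$, and $\Pi^\circ_{Q,p}B_2^n$ is its polar body. Set $$d_{n,p}(Q)=(n\omega_n)^{1/p}\left(nm\,\mathrm{vol}_{nm}(\Pi^\circ_{Q,p}B_2^n)\right)^{\frac1{nm}},$$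 $$\mathcal{E}_p(Q,f)=d_{n,p}(Q)\left(\int_{\mathbb{S}^{nm-1}}\left(\int_{\mathbb{R}^n}h_Q((\nabla f(z))^t\theta)^p\,dz\right)^{-\frac{nm}{p}}d\theta\right)^{-\frac1{nm}},$$ with $\mathcal{E}_p(Q,f)=0$ if $f=0$ a.e. $W_0^{1,p}(\Omega)$ is the completion of the smooth functions compactly supported in $\Omega$ under the norm $\|\nabla f\|_{L^p(\Omega)}+\|f\|_{L^p(\Omega)}$; its elements are extended by $0$ to $\mathbb{R}^n$. *)

(* Defs.v *)
From HB Require Import structures.
From mathcomp Require Import all_boot all_order all_algebra.
From mathcomp Require Import all_classical all_reals all_analysis.
From mathcomp Require Import measurable_realfun.

Set Implicit Arguments.
Unset Strict Implicit.
Unset Printing Implicit Defensive.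

Import Order.TTheory GRing.Theory Num.Theory.
Import numFieldNormedType.Exports.

Local Open Scope classical_set_scope.
Local Open Scope ring_scope.

(* R^n is 'cV[R]_n, R^m is 'rV[R]_m and R^{nm} is 'M[R]_(n, m) (the columns
   being x_1, ..., x_m), so that v^t x is v^T *m x.  The library norm `|x| on
   matrices is the max norm: it gives the usual topology, but Euclidean
   lengths are written enorm below. *)

Section euclidean.
Context {R : realType} {m n : nat}.
Implicit Types x y : 'M[R]_(m, n).

Definition dot x y : R := \sum_i \sum_j x i j * y i j.

Definition enorm x : R := Num.sqrt (dot x x).

Definition esphere : set 'M[R]_(m, n) := [set x | enorm x = 1].

Definition eball : set 'M[R]_(m, n) := [set x | enorm x <= 1].

End euclidean.

Arguments esphere {R} m n.
Arguments eball {R} m n.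

Section image_measure.
Context d1 d2 (T1 : measurableType d1) (T2 : measurableType d2) (R : realType).
Variables (mu : {sigma_finite_measure set T1 -> \bar R}).
Variables (f : T1 -> T2) (g : T2 -> T1).

(* The last three arguments are not used in the value: they make the image a
   sigma-finite measure. *)
Definition image_measure (_ : measurable_fun setT f) (_ : measurable_fun setT g)
    (_ : cancel f g) : set T2 -> \bar R := pushforward mu f.

Hypotheses (mf : measurable_fun setT f) (mg : measurable_fun setT g).
Hypothesis fK : cancel f g.

Local Notation nu := (image_measure mf mg fK).

Let nu_measure : isMeasure d2 T2 R nu.
Proof.
pose m : {measure set T2 -> \bar R} :=
  measure_function_pushforward__canonical__measure_function_Measure mu mf.
by apply: (@isMeasure.Build _ _ _ nu (measure0 m) (measure_ge0 m)
  (@measure_semi_sigma_additive _ _ _ m)).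
Qed.

HB.instance Definition _ := nu_measure.

Let nu_sigma_finite : sigma_finite setT nu.
Proof.
have [F FT Fmu] := sigma_finiteT mu.
exists (fun i => g @^-1` F i).
  by rewrite -preimage_bigcup -FT preimage_setT.
move=> i; have [mF Foo] := Fmu i; split.
  by rewrite -[X in measurable X]setTI; exact: mg.
rewrite /image_measure /pushforward (_ : f @^-1` _ = F i)//.
by apply/seteqP; split=> x; rewrite /preimage/= fK.
Qed.

HB.instance Definition _ := @Measure_isSigmaFinite.Build _ _ _ nu nu_sigma_finite.

End image_measure.

(* A copy of mu \x nu: the canonical sigma-finite structure that the library
   infers for \x only applies to sub-probability measures. *)
Section sigma_finite_product.
Context d1 d2 (T1 : measurableType d1) (T2 : measurableType d2) (R : realType).
Variables (mu : {sigma_finite_measure set T1 -> \bar R}).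
Variables (nu : {sigma_finite_measure set T2 -> \bar R}).

Definition sigma_finite_prod : set (T1 * T2) -> \bar R := (mu \x nu)%E.

HB.instance Definition _ := Measure.on sigma_finite_prod.

Let sigma_finite_prodT : sigma_finite setT sigma_finite_prod.
Proof.
have /sigma_finiteP[F [TF ndF Foo]] := sigma_finiteT mu.
have /sigma_finiteP[G [TG ndG Goo]] := sigma_finiteT nu.
exists (fun n => F n `*` G n).
  rewrite -setXTT TF TG predeqE => -[x y]; split.
    move=> [/= [n _ Fnx] [k _ Gky]]; exists (maxn n k) => //; split.
    - by move: x Fnx; exact/subsetPset/ndF/leq_maxl.
    - by move: y Gky; exact/subsetPset/ndG/leq_maxr.
  by move=> [n _ []/= ? ?]; split; exists n.
move=> k; have [? ?] := Foo k; have [? ?] := Goo k.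
split; first exact: measurableX.
by rewrite /sigma_finite_prod product_measure1E// lte_mul_pinfty// ge0_fin_numE.
Qed.

HB.instance Definition _ :=
  @Measure_isSigmaFinite.Build _ _ _ sigma_finite_prod sigma_finite_prodT.

End sigma_finite_product.

Section lebesgue_tuple.
Context {R : realType}.
Local Notation mR := (measurableTypeR R).

Definition cons_pair k (x : mR * k.-tuple mR) : k.+1.-tuple mR :=
  [the k.+1.-tuple mR of x.1 :: x.2].

Definition uncons_pair k (t : k.+1.-tuple mR) : mR * k.-tuple mR :=
  (thead t, [the k.-tuple mR of [tuple of behead t]]).

Lemma measurable_cons_pair k : measurable_fun setT (@cons_pair k).
Proof. exact: measurable_cons. Qed.

Lemma measurable_uncons_pair k : measurable_fun setT (@uncons_pair k).
Proof.
apply/measurable_fun_pair; first exact: measurable_tnth.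
exact: measurable_behead.
Qed.

Lemma cons_pairK k : cancel (@cons_pair k) (@uncons_pair k).
Proof.
by move=> [x t]; congr (_, _); apply/val_inj.
Qed.

Fixpoint lebesgue_tuple k : {sigma_finite_measure set (k.-tuple mR) -> \bar R} :=
  if k is k'.+1 then
    image_measure
      (sigma_finite_prod (@lebesgue_measure R) (lebesgue_tuple k'))
      (@measurable_cons_pair k') (@measurable_uncons_pair k') (@cons_pairK k')
  else \d_ ([tuple] : 0.-tuple mR).

End lebesgue_tuple.

Section matrix_measurable.
Context {R : realType} {m n : nat}.
Local Notation mR := (measurableTypeR R).

Definition mx_of_tuple (t : (m * n).-tuple mR) : 'M[R]_(m, n) :=
  vec_mx (\row_k tnth t k).

Definition tuple_of_mx (x : 'M[R]_(m, n)) : (m * n).-tuple mR :=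
  [tuple mxvec x 0 k | k < m * n].

Lemma mx_of_tupleK : cancel mx_of_tuple tuple_of_mx.
Proof.
by move=> t; apply: eq_from_tnth => k; rewrite tnth_mktuple vec_mxK mxE.
Qed.

Lemma tuple_of_mxK : cancel tuple_of_mx mx_of_tuple.
Proof.
move=> x; rewrite /mx_of_tuple -[RHS]mxvecK; congr vec_mx.
by apply/rowP => k; rewrite mxE tnth_mktuple.
Qed.

(* The product (equivalently, Borel) sigma-algebra, transported entrywise. *)
Definition measurable_mx : set (set 'M[R]_(m, n)) :=
  [set A | measurable (mx_of_tuple @^-1` A)].

Let measurable_mx0 : measurable_mx set0.
Proof. by rewrite /measurable_mx/= preimage_set0. Qed.

Let measurable_mxC A : measurable_mx A -> measurable_mx (~` A).
Proof. by move=> mA; rewrite /measurable_mx/= preimage_setC; exact: measurableC. Qed.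

Let measurable_mx_bigcup (F : (set 'M[R]_(m, n))^nat) :
  (forall i, measurable_mx (F i)) -> measurable_mx (\bigcup_i F i).
Proof.
move=> mF; rewrite /measurable_mx/= preimage_bigcup.
by apply: bigcup_measurable => i _; exact: mF.
Qed.

HB.instance Definition _ := @isMeasurable.Build default_measure_display
  'M[R]_(m, n) measurable_mx measurable_mx0 measurable_mxC measurable_mx_bigcup.

Lemma measurable_mx_of_tuple : measurable_fun setT mx_of_tuple.
Proof. by move=> _ A mA; rewrite setTI. Qed.

Lemma measurable_tuple_of_mx : measurable_fun setT tuple_of_mx.
Proof.
move=> _ A mA; rewrite setTI; rewrite /measurable/= /measurable_mx/=.
rewrite -comp_preimage (_ : _ \o _ = id) ?preimage_id//.
by apply/funext => t /=; exact: mx_of_tupleK.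
Qed.

Lemma measurable_entry i j : measurable_fun setT (fun x : 'M[R]_(m, n) => x i j).
Proof.
rewrite (_ : (fun x => _) = (fun x => tnth (tuple_of_mx x) (mxvec_index i j))).
  apply: (measurableT_comp (measurable_tnth (mxvec_index i j))).
  exact: measurable_tuple_of_mx.
by apply/funext => x; rewrite tnth_mktuple mxvecE.
Qed.

End matrix_measurable.

Definition vol {R : realType} (m n : nat)
    : {sigma_finite_measure set 'M[R]_(m, n) -> \bar R} :=
  image_measure (@lebesgue_tuple R (m * n)) (@measurable_mx_of_tuple R m n)
    (@measurable_tuple_of_mx R m n) (@mx_of_tupleK R m n).

Section surface.
Context {R : realType} (m n : nat).
Implicit Types x : 'M[R]_(m, n).

Lemma measurable_enorm : measurable_fun setT (@enorm R m n).
Proof.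
apply: (measurableT_comp (f := @Num.sqrt R)).
  by apply: continuous_measurable_fun; exact: sqrt_continuous.
apply: measurable_sum => i; apply: measurable_sum => j.
by apply: measurable_funM; exact: measurable_entry.
Qed.

Lemma measurable_eball : measurable (@eball R m n).
Proof.
rewrite (_ : eball m n = @enorm R m n @^-1` `]-oo, 1]); last first.
  by apply/seteqP; split => x; rewrite /eball/= in_itv.
by rewrite -[X in measurable X]setTI; exact: measurable_enorm.
Qed.

Definition normalize x := (enorm x)^-1 *: x.

Lemma measurable_normalize : measurable_fun setT normalize.
Proof.
rewrite (_ : normalize = mx_of_tuple \o (tuple_of_mx \o normalize)); last first.
  by apply/funext => x /=; rewrite tuple_of_mxK.
apply: (measurableT_comp measurable_mx_of_tuple).
apply/measurable_fun_tnthP => k.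
rewrite (_ : _ \o _ = fun x => (enorm x)^-1 * tnth (tuple_of_mx x) k); last first.
  by apply/funext => x /=; rewrite !tnth_mktuple /normalize linearZ mxE.
apply: measurable_funM.
  rewrite (_ : (fun x => _) = fun x => powR (enorm x) (-1)); last first.
    by apply/funext => x; rewrite powR_inv1// sqrtr_ge0.
  exact: (measurableT_comp (measurable_powR _) measurable_enorm).
exact: (measurableT_comp (measurable_tnth k) measurable_tuple_of_mx).
Qed.

(* Polar coordinates: d * vol_d of the cone {r u : u in A, 0 <= r <= 1} over A
   is the surface area of A (d = m * n); for d = 1 this is the counting measure
   on the two unit vectors.  It is carried by esphere m n. *)
Definition surface : set 'M[R]_(m, n) -> \bar R :=
  pushforward (mscale (m * n)%:R%:nng (mrestr (vol m n) measurable_eball)) normalize.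

Let nu : {measure set 'M[R]_(m, n) -> \bar R} :=
  measure_function_pushforward__canonical__measure_function_Measure
    (mscale (m * n)%:R%:nng (mrestr (vol m n) measurable_eball))
    measurable_normalize.

Let surface0 : surface set0 = 0%E. Proof. exact: (measure0 nu). Qed.

Let surface_ge0 A : (0 <= surface A)%E. Proof. exact: (measure_ge0 nu). Qed.

Let surface_sigma_additive : semi_sigma_additive surface.
Proof. exact: (@measure_semi_sigma_additive _ _ _ nu). Qed.

HB.instance Definition _ := isMeasure.Build _ _ _ surface
  surface0 surface_ge0 surface_sigma_additive.

End surface.

Arguments surface {R} m n _.

Section convex_bodies.
Context {R : realType} {m n : nat}.
Implicit Types (K Q : set 'M[R]_(m, n)) (x y : 'M[R]_(m, n)).

Definition convex_body K := [/\ compact K, convex_set K & K° !=set0].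

Definition origin_symmetric K := forall x, K x -> K (- x).

Definition support_fun K x : R := sup [set dot y x | y in K].

Definition polar K : set 'M[R]_(m, n) := [set y | forall x, K x -> dot x y <= 1].

End convex_bodies.

Section projection_body.
Local Open Scope ereal_scope.
Context {R : realType} {n m : nat}.
Implicit Types (Q : set 'rV[R]_m) (p : R).

Definition proj_support Q p (theta : 'M[R]_(n, m)) : \bar R :=
  (\int[surface n 1]_(v in esphere n 1)
     (support_fun Q (v^T *m theta) `^ p)%:E) `^ p^-1.

(* The convex body whose support function is proj_support Q p: a convex body is
   the intersection of its supporting half-spaces. *)
Definition proj_body Q p : set 'M[R]_(n, m) :=
  [set x | forall theta, (dot x theta)%:E <= proj_support Q p theta].

Definition dconst Q p : \bar R :=
  (n%:R%:E * vol n 1 (eball n 1)) `^ p^-1 *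
  ((n * m)%:R%:E * vol n m (polar (proj_body Q p))) `^ (n * m)%:R^-1.

End projection_body.

Arguments dconst {R} n {m} Q p.

Section sobolev.
Context {R : realType} {n : nat}.
Implicit Types (phi : 'cV[R]_n -> R) (Omega : set 'cV[R]_n) (p : R).

Definition partial (i : 'I_n) phi : 'cV[R]_n -> R :=
  fun x => 'D_(delta_mx i 0) phi x.

Definition gradient phi : 'cV[R]_n -> 'cV[R]_n :=
  fun x => \col_i partial i phi x.

Fixpoint continuously_differentiable (k : nat) phi : Prop :=
  if k is k'.+1 then
    continuous phi /\
    forall i : 'I_n, (forall x, derivable phi x (delta_mx i 0)) /\
      continuously_differentiable k' (partial i phi)
  else continuous phi.

Definition smooth phi := forall k, continuously_differentiable k phi.

Definition test_function Omega phi :=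
  [/\ smooth phi, compact (closure [set x | phi x != 0])
    & closure [set x | phi x != 0] `<=` Omega].

(* The completion of the test functions for ||grad phi||_p + ||phi||_p: an
   element is an L^p limit of test functions, together with the L^p limit of
   their gradients, both taken to be 0 outside Omega.  Test functions vanish
   outside Omega, so norms over R^n and over Omega agree here.  Classes modulo
   a.e. equality are given by Borel representatives. *)
Record sobolev0 Omega p := Sobolev0 {
  sobolev_fun :> 'cV[R]_n -> R ;
  sobolev_grad : 'cV[R]_n -> 'cV[R]_n ;
  sobolev_fun_measurable : measurable_fun setT sobolev_fun ;
  sobolev_grad_measurable : measurable_fun setT sobolev_grad ;
  sobolev_fun_out : forall z, ~ Omega z -> sobolev_fun z = 0 ;
  sobolev_grad_out : forall z, ~ Omega z -> sobolev_grad z = 0 ;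
  sobolev_approx : exists phi : nat -> 'cV[R]_n -> R,
    (forall k, test_function Omega (phi k)) /\
    ('N[vol n 1]_p%:E [(fun z => (enorm (gradient (phi k) z - sobolev_grad z))%:E)]
     + 'N[vol n 1]_p%:E [(fun z => (phi k z - sobolev_fun z)%:E)])%E
      @[k --> \oo] --> 0%E
}.

Local Open Scope ereal_scope.

(* The negative powers of the integrals are written as inverses of positive
   ones, because the library's poweR sends 0 to 0 and +oo to +oo for negative
   exponents, while 0^-1 = +oo and +oo^-1 = 0 in \bar R. *)
Definition energy m (Q : set 'rV[R]_m) Omega p (f : sobolev0 Omega p) : \bar R :=
  if `[< {ae vol n 1, forall z, f z = 0%R} >] then 0 else
  dconst n Q p *
  ((\int[surface n m]_(theta in esphere n m)
      ((\int[vol n 1]_z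
          (support_fun Q ((sobolev_grad f z)^T *m theta) `^ p)%:E)
         `^ ((n * m)%:R / p))^-1) `^ (n * m)%:R^-1)^-1.

End sobolev.

(* Main.v *)
Require Import Defs.
From mathcomp Require Import all_boot all_order all_algebra.
From mathcomp Require Import all_classical all_reals all_analysis.
From mathcomp Require Import measurable_realfun.
From mathcomp Require Import ring lra.
Set Implicit Arguments.
Unset Strict Implicit.
Unset Printing Implicit Defensive.

Import Order.TTheory GRing.Theory Num.Theory.
Import numFieldNormedType.Exports.

Local Open Scope classical_set_scope.
Local Open Scope ring_scope.

(** The affine energy is bounded below direction by direction, by a
    one-dimensional Poincare inequality.

    Let theta be a unit matrix.  One of its n * m entries, say the one at
    (i, j), has absolute value more than 1 / (2 n m)
    ([esphere_large_entry]); let u be the j-th column of theta.  As Q contains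
    a cube of half-side r, its support function dominates r times each
    coordinate, so h_Q((grad f)^t theta) >= r |u . grad f|
    ([le_support_fun]): the integrand controls one directional derivative
    of f.

    A directional derivative alone controls f.  The i-th coordinate of u is
    bounded away from 0, so there is a time T, the same for all theta, at which
    a point moving from anywhere in the bounded set Omega with velocity u is
    outside Omega.  The value of a test function phi is thus minus the integral
    of u . grad phi along this path.  Taking p-th powers
    ([power_mean]), integrating over space, exchanging the integrals and using
    the translation invariance of the volume gives
    ||phi||_p <= T ||u . grad phi||_p ([directional_poincare]); Minkowski's
    inequality carries this over to the Sobolev space ([sobolev_poincare]).

    Consequently the inner integral of the energy is at least (c ||f||_p)^p
    with c = r / T independent of theta ([directional_energy_ge]).  The energy
    is a monotone function of the inner integrals, the sphere has finite
    area, and the remaining exponents cancel ([inve_root_le]), which leaves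
    energy >= dconst * c ||f||_p / area^(1/nm).  Finally dconst is positive:
    the support function of the projection body is bounded on the coordinate
    directions, so the body is bounded and its polar contains a cube
    ([dconst_gt0]). *)

(** * Integrals and measurability on spaces of matrices *)

Section monotone_integral.
Local Open Scope ereal_scope.
Context d (T : measurableType d) (R : realType) (mu : {measure set T -> \bar R}).

(** The integral of a nonnegative function is a supremum over the simple
    functions below it, hence monotone for arbitrary nonnegative integrands.
    This is what allows comparing the integrals over the sphere in the energy
    and in the projection body. *)
Lemma le_integral_nonneg (D : set T) (f g : T -> \bar R) :
  (forall x, D x -> 0 <= f x) -> (forall x, D x -> f x <= g x) ->
  \int[mu]_(x in D) f x <= \int[mu]_(x in D) g x.
Proof.
move=> f0 fg; have g0 x : D x -> 0 <= g x.
  by move=> Dx; exact: le_trans (f0 x Dx) (fg x Dx).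
rewrite !ge0_integralE//; apply: le_ereal_sup => _ [h /= hf <-]; exists h => //= x.
apply: le_trans (hf x) _; rewrite /patch; case: ifPn => // /set_mem; exact: fg.
Qed.

End monotone_integral.

Section open_measurable.
Context {R : realType} {m n : nat}.
Implicit Types (A : set 'M[R]_(m, n)).

Lemma measurable_fun_mx d (S : measurableType d) (f : S -> 'M[R]_(m, n)) :
  (forall i j, measurable_fun setT (fun x => f x i j)) -> measurable_fun setT f.
Proof.
move=> mf; rewrite (_ : f = mx_of_tuple \o (tuple_of_mx \o f)); last first.
  by apply/funext => x /=; rewrite tuple_of_mxK.
apply: (measurableT_comp measurable_mx_of_tuple).
apply/measurable_fun_tnthP => k; case/mxvec_indexP: k => i j.
rewrite (_ : _ \o _ = fun x => f x i j); first exact: mf.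
by apply/funext => x /=; rewrite tnth_mktuple mxvecE.
Qed.

Lemma mx_ballP (x y : 'M[R]_(m, n)) (e : R) : 0 < e ->
  (ball x e y <-> forall i j, `|x i j - y i j| < e).
Proof. by move=> e0; split=> [[]|]. Qed.

Lemma measurable_mx_box (lo hi : 'M[R]_(m, n)) :
  measurable [set x : 'M[R]_(m, n) | forall i j, lo i j < x i j < hi i j].
Proof.
rewrite (_ : [set x | _] = \bigcap_(i in [set: 'I_m]) \bigcap_(j in [set: 'I_n])
    ((fun x : 'M[R]_(m, n) => x i j) @^-1` `]lo i j, hi i j[)); last first.
  apply/seteqP; split=> [x h i _ j _|x h i j] /=; rewrite ?in_itv/=.
    exact: h.
  by move: (h i I j I); rewrite /= in_itv.
apply: fin_bigcap_measurable => // i _; apply: fin_bigcap_measurable => // j _.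
rewrite -[X in measurable X]setTI; exact: measurable_entry.
Qed.

(** The matrix space is second countable: an open set is the union of the balls
    with rational centre and radius 1/(k+1) that it contains, and balls of the
    max norm are boxes. *)
Lemma open_measurable_mx A : open A -> measurable A.
Proof.
move=> oA.
pose B (q : 'M[rat]_(m, n) * nat) : set 'M[R]_(m, n) :=
  ball (map_mx ratr q.1 : 'M[R]_(m, n)) q.2.+1%:R^-1.
pose C q := if `[< B q `<=` A >] then B q else set0.
have mC q : measurable (C q).
  rewrite /C; case: ifPn => _; last exact: measurable0.
  rewrite (_ : B q = [set x | forall i j, ratr (q.1 i j) - q.2.+1%:R^-1 < x i j
      < ratr (q.1 i j) + q.2.+1%:R^-1]); last first.
    apply/seteqP; split => x.
      move=> /(mx_ballP _ _ _) h i j; have := h _ i j.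
      by rewrite mxE distrC ltr_distl; apply.
    by move=> /= h; apply/mx_ballP => // i j; rewrite mxE distrC ltr_distl.
  have := measurable_mx_box (\matrix_(i, j) (ratr (q.1 i j) - q.2.+1%:R^-1))
    (\matrix_(i, j) (ratr (q.1 i j) + q.2.+1%:R^-1)).
  by under eq_fun do under eq_forall do under eq_forall do rewrite !mxE.
rewrite (_ : A = \bigcup_q C q); last first.
  apply/seteqP; split => [x Ax|x [q _]]; last first.
    by rewrite /C; case: asboolP => // + Bx; exact.
  have /nbhs_ballP[e /= e0 eA] : nbhs x A by exact: open_nbhs_nbhs.
  have [k ke] : exists k, k.+1%:R^-1 < e / 2.
    have e20 : 0 < e / 2 by lra.
    have [k _ /(_ k (leqnn _))/=] := near_infty_natSinv_lt (PosNum e20).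
    by exists k.
  have k0 : 0 < k.+1%:R^-1 :> R by rewrite invr_gt0.
  have h i j : {r : rat | `|ratr r - x i j| < k.+1%:R^-1}.
    apply: cid; have : x i j - k.+1%:R^-1 < x i j + k.+1%:R^-1.
      by rewrite ltrD2l gtrN.
    move=> /rat_in_itvoo[r]; rewrite in_itv/= => rx.
    by exists r; rewrite ltr_distl.
  exists (\matrix_(i, j) sval (h i j), k) => //.
  rewrite /C asboolT.
    by apply/mx_ballP => // i j; rewrite !mxE; case: (h i j).
  move=> y /(mx_ballP _ _ k0) hy; apply: eA; apply/(mx_ballP _ _ e0) => i j.
  have := hy i j; rewrite !mxE; case: (h i j) => r /= hr hr'.
  rewrite -(subrK (ratr r) (x i j)) -addrA (le_lt_trans (ler_normD _ _))//.
  rewrite (splitr e); apply: ltrD; [rewrite distrC|]; exact: lt_trans ke.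
by apply: countable_bigcupT_measurable; [exact: countableP|].
Qed.

Lemma continuous_measurable_mx (f : 'M[R]_(m, n) -> R) :
  continuous f -> measurable_fun setT f.
Proof.
move=> /continuousP cf; apply: (measurability _ (RGenOpens.measurableE R)).
move=> _ [_ [a [b ->]] <-]; rewrite setTI.
by apply: open_measurable_mx; exact/cf/interval_open.
Qed.

End open_measurable.

(** * Translation invariance and the volume of cubes *)

Section translation.
Context {R : realType}.
Local Notation mR := (measurableTypeR R).
Local Notation mu := (@lebesgue_measure R).

Lemma measurable_shift (a : R) : measurable_fun setT (fun x : mR => x + a : mR).
Proof. by apply: measurable_funD => //; exact: measurable_cst. Qed.

(** A translation preserves the length of intervals, and these determine Lebesgue
    measure on Borel sets. *)
Lemma lebesgue_measure_shift (a : R) (A : set mR) : measurable A ->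
  mu ((fun x : mR => x + a : mR) @^-1` A) = mu A.
Proof.
move=> mA; pose nu : {measure set mR -> \bar R} :=
  measure_function_pushforward__canonical__measure_function_Measure mu
    (measurable_shift a).
apply/esym/(lebesgue_measure_unique (mu := nu)) => //.
move=> _ [[b c] _ <-]; rewrite /= /pushforward.
rewrite (_ : _ @^-1` _ = `]b - a, c - a]%classic).
  rewrite !lebesgue_measure_itv/= !lte_fin ltrD2r.
  by case: ifPn => // _; congr EFin; ring.
by apply/seteqP; split => x /=; rewrite !in_itv/= ltrBlDr lerBrDr.
Qed.

Lemma ge0_integral_shift (a : R) (G : mR -> \bar R) : measurable_fun setT G ->
  (forall x, 0 <= G x)%E ->
  (\int[mu]_x G (x + a)%R = \int[mu]_x G x)%E.
Proof.
move=> mG G0.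
have := @ge0_integral_pushforward _ _ _ _ R _ (measurable_shift a) mu setT G
  measurableT mG (fun x _ => G0 x).
rewrite preimage_setT => <-.
apply: eq_measure_integral => [|mphi A mA _]; first exact: measurable_shift.
exact: lebesgue_measure_shift.
Qed.

Definition shift_tuple k (a t : k.-tuple mR) : k.-tuple mR :=
  [tuple tnth t i + tnth a i | i < k].

(** The measure on tuples is built by slicing off the head, so statements about
    it go by induction on the length through this formula. *)
Lemma lebesgue_tupleS k (A : set (k.+1.-tuple mR)) :
  lebesgue_tuple k.+1 A =
  (\int[mu]_x lebesgue_tuple k [set t | A (cons_pair (x, t))])%E.
Proof.
apply: eq_integral => x _; congr (lebesgue_tuple k _).
by apply/seteqP; split => t /=; rewrite /xsection/= inE.
Qed.

Lemma measurable_lebesgue_tupleS k (A : set (k.+1.-tuple mR)) : measurable A ->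
  measurable_fun setT
    (fun x : mR => lebesgue_tuple k [set t | A (cons_pair (x, t))]).
Proof.
move=> mA; rewrite (_ : (fun x => _) =
  lebesgue_tuple k \o xsection (@cons_pair R k @^-1` A)).
  apply: measurable_fun_xsection.
  by rewrite -[X in measurable X]setTI; exact: measurable_cons_pair.
apply/funext => x /=; congr (lebesgue_tuple k _).
by apply/seteqP; split => t /=; rewrite /xsection/= inE.
Qed.

Lemma shift_cons_pair k (a : k.+1.-tuple mR) x (t : k.-tuple mR) :
  shift_tuple a (cons_pair (x, t)) =
  cons_pair (x + tnth a ord0, shift_tuple [tuple of behead a] t).
Proof.
apply: eq_from_tnth => i; rewrite tnth_mktuple.
case: (unliftP ord0 i) => [j|] ->; last by rewrite !tnth0.
rewrite !tnthS tnth_mktuple tnth_behead; congr (_ + tnth _ _).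
by apply/val_inj; rewrite /= inordK ?ltnS ?ltn_ord.
Qed.

Lemma lebesgue_tuple_shift k (a : k.-tuple mR) (A : set (k.-tuple mR)) :
  measurable A -> lebesgue_tuple k (shift_tuple a @^-1` A) = lebesgue_tuple k A.
Proof.
elim: k a A => [|k IH] a A mA.
  congr (lebesgue_tuple 0 _); apply/seteqP; split=> t;
    by rewrite /preimage/= (tuple0 (shift_tuple a t)) (tuple0 t).
rewrite !lebesgue_tupleS.
rewrite -(ge0_integral_shift (tnth a ord0) (measurable_lebesgue_tupleS mA))//.
apply: eq_integral => x _.
rewrite -[RHS](IH [tuple of behead a]).
  by congr (lebesgue_tuple k _); apply/seteqP; split => t /=;
    rewrite /preimage/= shift_cons_pair.
have mc : measurable_fun setT
    (fun t : k.-tuple mR => cons_pair (x + tnth a ord0, t)).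
  apply: (measurableT_comp (measurable_cons_pair (k := k))).
  exact: measurable_pair1.
by rewrite -[X in measurable X]setTI; exact: mc.
Qed.

End translation.

Section cube_volume.
Context {R : realType}.
Local Notation mR := (measurableTypeR R).
Local Notation mu := (@lebesgue_measure R).

Definition cube_tuple k (r : R) : set (k.-tuple mR) :=
  [set t | forall i, `|tnth t i| <= r].

Lemma measurable_cube_tuple k r : measurable (@cube_tuple k r).
Proof.
rewrite (_ : cube_tuple r = \bigcap_(i in [set: 'I_k])
    ((fun t : k.-tuple mR => tnth t i) @^-1` `[- r, r])); last first.
  apply/seteqP; split=> [t h i _|t h i] /=.
    by rewrite in_itv/= -ler_norml h.
  by move: (h i I); rewrite /= in_itv/= -ler_norml.
apply: fin_bigcap_measurable => // i _.
by rewrite -[X in measurable X]setTI; apply: measurable_tnth.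
Qed.

Lemma lebesgue_tuple_cube k (r : R) : 0 < r ->
  lebesgue_tuple k (cube_tuple r) = ((r *+ 2) ^+ k)%:E.
Proof.
move=> r0; elim: k => [|k IH].
  by rewrite expr0 /= diracE mem_set// => -[].
rewrite exprS EFinM -IH.
have mur : mu `[- r, r]%classic = (r *+ 2)%:E.
  by rewrite lebesgue_measure_itv/= lte_fin gtrN// opprK mulr2n.
transitivity ((mu \x lebesgue_tuple k)%E (`[- r, r]%classic `*` cube_tuple r)).
  congr ((mu \x lebesgue_tuple k)%E _); apply/seteqP; split => [[x t]|[x t] [/=]].
    rewrite /cube_tuple/= => h; split => /=.
      by rewrite in_itv/= -ler_norml; have := h ord0; rewrite tnth0.
    by move=> i; have := h (lift ord0 i); rewrite tnthS.
  rewrite in_itv/= -ler_norml => xr tr i.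
  by case: (unliftP ord0 i) => [j|] ->; rewrite ?tnth0 ?tnthS.
rewrite product_measure1E//; last exact: measurable_cube_tuple.
by congr (_ * _)%E; exact: mur.
Qed.

End cube_volume.

Section volume.
Context {R : realType} {m n : nat}.
Local Notation mx := 'M[R]_(m, n).

Definition cube (r : R) : set mx := [set x | forall i j, `|x i j| <= r].

Lemma preimage_cube (r : R) : mx_of_tuple @^-1` cube r = cube_tuple r.
Proof.
apply/seteqP; split => t; rewrite /cube/=.
  by move=> h k; case/mxvec_indexP: k => i j; have := h i j; rewrite !mxE.
by move=> h i j; rewrite !mxE.
Qed.

Lemma measurable_cube (r : R) : measurable (cube r).
Proof.
rewrite /measurable/= /measurable_mx/= preimage_cube.
exact: measurable_cube_tuple.
Qed.

Lemma vol_cube (r : R) : 0 < r -> vol m n (cube r) = ((r *+ 2) ^+ (m * n))%:E.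
Proof.
move=> r0; rewrite -lebesgue_tuple_cube//.
by congr (lebesgue_tuple (m * n) _); exact: preimage_cube.
Qed.

Lemma measurable_mx_shift (a : mx) : measurable_fun setT (fun x : mx => x + a).
Proof.
apply: measurable_fun_mx => i j; under eq_fun do rewrite mxE.
by apply: measurable_funD; [exact: measurable_entry|exact: measurable_cst].
Qed.

Lemma vol_shift (a : mx) (A : set mx) : measurable A ->
  vol m n ((fun x => x + a) @^-1` A) = vol m n A.
Proof.
move=> mA.
have E t : mx_of_tuple t + a = mx_of_tuple (shift_tuple (tuple_of_mx a) t).
  by apply/matrixP => i j; rewrite !mxE !tnth_mktuple !mxvecE.
rewrite -[RHS](lebesgue_tuple_shift (tuple_of_mx a) mA).
congr (lebesgue_tuple (m * n) _).
by apply/seteqP; split => t; rewrite /preimage/mkset E.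
Qed.

Lemma ge0_integral_vol_shift (a : mx) (g : mx -> \bar R) : measurable_fun setT g ->
  (forall x, 0 <= g x)%E ->
  (\int[vol m n]_x g (x + a)%R = \int[vol m n]_x g x)%E.
Proof.
move=> mg g0.
have := @ge0_integral_pushforward _ _ _ _ R _ (measurable_mx_shift a) (vol m n) setT g
  measurableT mg (fun x _ => g0 x).
rewrite preimage_setT => <-.
apply: eq_measure_integral => [|mphi A mA _]; first exact: measurable_mx_shift.
exact: vol_shift.
Qed.

End volume.

(** * Directional derivatives *)

Section directional_derivative.
Context {R : realType} {V : normedModType R}.
Implicit Types (f : V -> R) (v e x y : V).

Lemma is_derive_cvgP f x v (d : R) : is_derive x v f d <->
  (h^-1 * (f (h *: v + x) - f x)) @[h --> 0^'] --> d.
Proof.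
split=> [[df dE]|h]; first by rewrite -dE; exact: df.
by apply: DeriveDef; [apply/cvg_ex; exists d|apply/cvg_lim].
Qed.

Lemma is_derive_line f e y (t d : R) : is_derive (t *: e + y) e f d ->
  is_derive t 1 (fun s : R => f (s *: e + y)) d.
Proof.
move=> /is_derive_cvgP h; apply: DeriveDef;
  [apply/cvg_ex; exists d|apply/cvg_lim => //];
under eq_fun do rewrite /= scaler1 scalerDl -addrA; exact: h.
Qed.

Lemma mean_value_line f e (de : V -> R) y (s : R) :
  (forall z, is_derive z e f (de z)) ->
  exists2 xi : R, `|xi| <= `|s| & f (s *: e + y) - f y = de (xi *: e + y) * s.
Proof.
move=> fe; pose g := fun t : R => f (t *: e + y).
have gd (t : R) : is_derive t 1 g (de (t *: e + y)) by exact: is_derive_line.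
have gc A : {within A, continuous g}.
  apply: continuous_subspaceT => t.
  by apply: differentiable_continuous; apply/derivable1_diffP; exact: ex_derive.
have g0 : g 0 = f y by rewrite /g scale0r add0r.
rewrite -g0 -/(g s); have [s0|s0] := leP 0 s.
  have [c] := MVT_segment s0 (fun t _ => gd t) (gc _).
  rewrite in_itv/= subr0 => /andP[c0 cs] ->; exists c => //.
  by rewrite !ger0_norm.
have [c] := MVT_segment (ltW s0) (fun t _ => gd t) (gc _).
rewrite in_itv/= sub0r => /andP[sc c0] gs; exists c.
  by rewrite !ler0_norm ?(ltW s0)// lerN2.
by rewrite -opprB gs mulrN opprK.
Qed.

(** The increment of f along h (v + c e) is the increment along h v followed by
    one along h c e.  The mean value theorem writes the second as h c times a
    value of the derivative at a point tending to x, and continuity of that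
    derivative gives the limit. *)
Lemma is_derive_add_direction f v e (c d : R) (de : V -> R) x :
  is_derive x v f d -> (forall z, is_derive z e f (de z)) ->
  {for x, continuous de} -> is_derive x (v + c *: e) f (d + c * de x).
Proof.
move=> /is_derive_cvgP fv fe cde; apply/is_derive_cvgP.
have /choice[xi xiP] (h : R) : exists t : R, `|t| <= `|h * c| /\
    f ((h * c) *: e + (h *: v + x)) - f (h *: v + x)
    = de (t *: e + (h *: v + x)) * (h * c).
  by have [t ? ?] := mean_value_line (h *: v + x) (h * c) fe; exists t.
have xi0 : xi h @[h --> 0^'] --> 0.
  apply/cvgrPdist_le => eps eps0; near=> h.
  rewrite sub0r normrN (le_trans (xiP h).1)// normrM.
  have c0 : 0 < `|c| + 1 by rewrite ltr_wpDl.
  apply: (@le_trans _ _ (`|h| * (`|c| + 1))); first by rewrite ler_wpM2l// lerDl.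
  rewrite -ler_pdivlMr//.
  by near: h; apply: dnbhs0_le; rewrite divr_gt0.
(* The zero vectors of the limit are written as 0 *: e and 0 *: v, to match the
   shape of the moving point. *)
have cv : xi h *: e + (h *: v + x) @[h --> 0^'] --> x.
  rewrite -[X in _ --> X]add0r -[X in _ --> X + _](scale0r e).
  rewrite -[X in _ --> _ + X]add0r -[X in _ --> _ + (X + _)](scale0r v).
  apply: cvgD; first exact: cvgZr_tmp.
  apply: cvgD; last exact: cvg_cst.
  apply: cvgZr_tmp; exact: nbhs_dnbhs.
have cv2 : c * de (xi h *: e + (h *: v + x)) @[h --> 0^'] --> c * de x.
  by apply: cvgMl_tmp; exact: (cvg_comp _ _ cv cde).
rewrite (addrC d).
apply: (cvg_trans _ (@cvgD _ _ _ _ _ _ _ _ _ cv2 fv)); apply: near_eq_cvg.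
near=> h; have h0 : h != 0 by near: h; exact: nbhs_dnbhs_neq.
rewrite /= scalerDr scalerA (addrC (h *: v)) -addrA.
rewrite -[in RHS](subrK (f (h *: v + x)) (f ((h * c) *: e + _))) (xiP h).2.
by rewrite fctE; field.
Unshelve. all: by end_near.
Qed.

(** Adding the directions one at a time turns continuous partial derivatives
    into a derivative in every direction, without a detour through the
    differential. *)
Lemma is_derive_sum_directions (I : eqType) (e : I -> V) (c : I -> R)
    (f : V -> R) (de : I -> V -> R) (s : seq I) x :
  (forall i z, is_derive z (e i) f (de i z)) -> (forall i, continuous (de i)) ->
  is_derive x (\sum_(i <- s) c i *: e i) f (\sum_(i <- s) c i * de i x).
Proof.
move=> fe cde; elim: s => [|i s IH].
  rewrite !big_nil; apply/is_derive_cvgP.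
  under eq_fun do rewrite scaler0 add0r subrr mulr0; exact: cvg_cst.
rewrite !big_cons addrC [X in is_derive _ _ _ X]addrC.
by apply: is_derive_add_direction => //; exact: cde.
Qed.

End directional_derivative.

(** * Powers of integrals *)

Section power_mean.
Local Open Scope ereal_scope.
Context d (S : measurableType d) (R : realType) (mu : {measure set S -> \bar R}).

Lemma le_poweR (x y : \bar R) (r : R) : (0 <= r)%R -> 0 <= x -> x <= y ->
  x `^ r <= y `^ r.
Proof.
move=> r0 x0 xy; apply: gt0_ler_poweR; rewrite ?r0//.
- by rewrite in_itv/= x0 leey.
- by rewrite in_itv/= (le_trans x0 xy) leey.
Qed.

(** Jensen's inequality for t |-> t^p on a set of mass T, obtained from
    Hoelder's inequality applied to |g| 1_I and 1_I. *)
Lemma power_mean (I : set S) (T p : R) (g : S -> R) : measurable I ->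
  mu I = T%:E -> (1 <= p)%R -> measurable_fun setT g ->
  (\int[mu]_(t in I) `|g t|%:E) `^ p <=
  (T `^ (p - 1))%:E * \int[mu]_(t in I) (`|g t| `^ p)%:E.
Proof.
move=> mI + + mg; rewrite le_eqVlt => + /predU1P[<-|p1].
  move=> muI.
  rewrite subrr powRr0 mul1e poweRe1; last first.
    by apply: integral_ge0 => x _; rewrite lee_fin.
  by apply: le_integral_nonneg => x _; rewrite ?lee_fin// powRr1.
have p0 : (0 < p)%R by lra.
pose q := (p / (p - 1))%R.
have q0 : (0 < q)%R by rewrite divr_gt0//; lra.
have pq : (p^-1 + q^-1 = 1)%R by rewrite /q; field; lra.
have qp : (q^-1 * p = p - 1)%R by rewrite /q; field; lra.
move=> muI; have T0 : (0 <= T)%R by rewrite -lee_fin -muI measure_ge0.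
pose b : S -> R := \1_I.
have mb : measurable_fun setT b by exact: measurable_indic.
pose a := (fun t => `|g t| * b t)%R.
have ma : measurable_fun setT a.
  by apply: measurable_funM => //; exact: measurableT_comp.
have b01 t : b t = 1%R \/ b t = 0%R.
  by rewrite /b indicE; case: (t \in I); [left|right].
have := hoelder mu ma mb p0 q0 pq.
have -> : 'N[mu]_1[(EFin \o (a \* b)%R)] = \int[mu]_(t in I) `|g t|%:E.
  rewrite Lnorm1 [RHS]integral_mkcond; apply: eq_integral => t _.
  rewrite /patch/= /a /b indicE; case: ifPn => _.
    by rewrite !mulr1 normr_id.
  by rewrite !mulr0 normr0.
have Na : 'N[mu]_p%:E[EFin \o a] = (\int[mu]_(t in I) (`|g t| `^ p)%:E) `^ p^-1.
  rewrite unlock; congr (_ `^ _); rewrite [RHS]integral_mkcond.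
  apply: eq_integral => t _.
  rewrite /patch/= /a /b indicE; case: ifPn => _.
    by rewrite !mulr1 normr_id.
  by rewrite !mulr0 normr0 powR0// gt_eqF.
have Nb : 'N[mu]_q%:E[EFin \o b] = (T `^ q^-1)%:E.
  rewrite unlock -poweR_EFin -muI; congr (_ `^ _).
  transitivity (\int[mu]_t (b t)%:E); last by rewrite integral_indic// setIT.
  apply: eq_integral => t _ /=.
  by have [->|->] := b01 t; rewrite ?normr1 ?normr0 ?powR1 ?powR0// gt_eqF.
rewrite Na Nb => H.
have I0 : 0 <= \int[mu]_(t in I) (`|g t| `^ p)%:E.
  by apply: integral_ge0 => x _; rewrite lee_fin powR_ge0.
have J0 : 0 <= \int[mu]_(t in I) `|g t|%:E.
  by apply: integral_ge0 => x _; rewrite lee_fin.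
apply: le_trans (le_poweR (ltW p0) J0 H) _.
rewrite poweRM ?poweR_ge0 ?lee_fin ?powR_ge0// -poweRrM mulVf ?gt_eqF//.
rewrite poweRe1// poweR_EFin -powRrM muleC.
by rewrite qp.
Qed.

End power_mean.

Section Lnorm_lemmas.
Local Open Scope ereal_scope.
Context d (S : measurableType d) (R : realType) (mu : {measure set S -> \bar R}).
Variable p : R.
Hypothesis p0 : (0 < p)%R.

Lemma Lnorm_EFinE (f : S -> R) :
  'N[mu]_p%:E[EFin \o f] = (\int[mu]_x (`|f x| `^ p)%:E) `^ p^-1.
Proof. by rewrite unlock. Qed.

Lemma poweR_Lnorm_EFin (f : S -> R) :
  'N[mu]_p%:E[EFin \o f] `^ p = \int[mu]_x (`|f x| `^ p)%:E.
Proof. by rewrite poweR_Lnorm ?gt_eqF//. Qed.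

Lemma le_Lnorm (f g : S -> R) : (forall x, `|f x| <= `|g x|)%R ->
  'N[mu]_p%:E[EFin \o f] <= 'N[mu]_p%:E[EFin \o g].
Proof.
move=> fg; rewrite !Lnorm_EFinE; apply: le_poweR.
- by rewrite invr_ge0 ltW.
- by apply: integral_ge0 => x _; rewrite lee_fin powR_ge0.
- apply: le_integral_nonneg => x _; rewrite lee_fin; first exact: powR_ge0.
  by apply: ge0_ler_powR; rewrite ?nnegrE// ltW.
Qed.

Lemma LnormZ (c : R) (f : S -> R) : (0 <= c)%R -> measurable_fun setT f ->
  'N[mu]_p%:E[EFin \o (fun x => c * f x)%R] = c%:E * 'N[mu]_p%:E[EFin \o f].
Proof.
move=> c0 mf; rewrite !Lnorm_EFinE.
rewrite (eq_integral (fun x => (c `^ p)%:E * (`|f x| `^ p)%:E)); last first.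
  by move=> x _; rewrite normrM (ger0_norm c0) powRM// EFinM.
rewrite ge0_integralZl_EFin//; last 2 first.
- apply/measurable_EFinP; apply: (measurableT_comp (measurable_powR p)).
  exact: measurableT_comp.
- exact: powR_ge0.
rewrite poweRM ?lee_fin ?powR_ge0//; last first.
  by apply: integral_ge0 => x _; rewrite lee_fin powR_ge0.
by rewrite poweR_EFin -powRrM divff ?gt_eqF// powRr1.
Qed.

End Lnorm_lemmas.

(** * Poincare inequality in one direction *)

Section directional_poincare.
Local Open Scope ereal_scope.
Context {R : realType} {m n : nat}.
Local Notation mx := 'M[R]_(m, n).
Local Notation mR := (measurableTypeR R).
Local Notation mu := (@lebesgue_measure R).

Lemma measurable_line (u : mx) :
  measurable_fun setT (fun z : mx * mR => (z.2 : R) *: u + z.1)%R.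
Proof.
apply: measurable_fun_mx => i j; under eq_fun do rewrite !mxE.
apply: measurable_funD.
  by apply: measurable_funM; [exact: measurable_snd|exact: measurable_cst].
by apply: (measurableT_comp (measurable_entry i j)); exact: measurable_fst.
Qed.

Lemma continuous_line (D : mx -> R) (u x : mx) : continuous D ->
  continuous (fun t : R => D (t *: u + x)%R).
Proof.
move=> cD t.
have h : (s *: u + x @[s --> t] --> t *: u + x)%R.
  by apply: cvgD; [apply: cvgZr_tmp; exact: cvg_id|exact: cvg_cst].
exact: (cvg_comp _ _ h (cD _)).
Qed.

(** Fundamental theorem of calculus along the segment from x to x + T u. *)
Lemma increment_le_integral (phi D : mx -> R) (u x : mx) (T : R) : (0 < T)%R ->
  continuous D -> (forall z, is_derive z u phi (D z)) ->
  `|phi (T *: u + x)%R - phi x|%:E <=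
  \int[mu]_(t in `[0%R, T]) `|D (t *: u + x)%R|%:E.
Proof.
move=> T0 cD dphi.
pose F (t : R) := phi (t *: u + x)%R.
have dF (t : R) : is_derive t (1 : R)%R F (D (t *: u + x)%R) by exact: is_derive_line.
have cF : continuous F.
  move=> t; apply: differentiable_continuous.
  by apply/derivable1_diffP; exact: ex_derive.
have cl := @continuous_line D u x cD.
have FTC : \int[mu]_(t in `[0%R, T]) (D (t *: u + x)%R)%:E = (F T)%:E - (F 0%R)%:E.
  apply: continuous_FTC2 => //.
  - exact: continuous_subspaceT.
  - split=> [t _||]; first exact: ex_derive.
    + by apply: cvg_at_right_filter; exact: cF.
    + by apply: cvg_at_left_filter; exact: cF.
  - by move=> t _; rewrite derive1E; exact: derive_val.
rewrite (_ : phi x = F 0%R); last by rewrite /F scale0r add0r.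
rewrite -/(F T) -abse_EFin EFinB -FTC.
apply: le_abse_integral => //; apply/measurable_EFinP.
by apply: measurable_funTS; exact: continuous_measurable_fun.
Qed.

(** When at least one end of every segment [z, z + T u] is a zero of phi, the
    value |phi z| is at most the integral of |D| along the segment.  The power
    mean inequality bounds |phi z|^p by T^(p-1) times the integral of |D|^p, and
    after exchanging the integrals each slice in t is a translate of the same
    space integral, which gives one more factor T. *)
Lemma directional_poincare (phi D : mx -> R) (u : mx) (T p : R) :
  (0 < T)%R -> (1 <= p)%R -> continuous D ->
  (forall z, is_derive z u phi (D z)) ->
  (forall z, phi z = 0%R \/ phi (T *: u + z)%R = 0%R) ->
  'N[vol m n]_p%:E[EFin \o phi] <= T%:E * 'N[vol m n]_p%:E[EFin \o D].
Proof.
move=> T0 p1 cD dphi phi0.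
have p0 : (0 < p)%R by exact: lt_le_trans p1.
have muI : mu `[0%R, T]%classic = T%:E.
  by rewrite lebesgue_measure_itv/= lte_fin T0 EFinN sube0.
have mD := continuous_measurable_mx cD.
have pw (x : mx) : (`|phi x| `^ p)%:E <=
    (T `^ (p - 1))%:E * \int[mu]_(t in `[0%R, T]) (`|D (t *: u + x)%R| `^ p)%:E.
  have r0 : 0 <= (T `^ (p - 1))%:E *
      \int[mu]_(t in `[0%R, T]) (`|D (t *: u + x)%R| `^ p)%:E.
    rewrite mule_ge0 ?lee_fin ?powR_ge0//.
    by apply: integral_ge0 => t _; rewrite lee_fin powR_ge0.
  have [->|Tx] := phi0 x; first by rewrite normr0 powR0// gt_eqF.
  apply: le_trans; last apply: power_mean => //; last first.
    by apply: continuous_measurable_fun; exact: continuous_line.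
  rewrite -poweR_EFin; apply: le_poweR; [exact: ltW|by rewrite lee_fin|].
  have := increment_le_integral x T0 cD dphi.
  by rewrite Tx sub0r normrN.
(* The indicator of [0, T] turns the integral over the segment into one over
   the whole line, as Tonelli's theorem requires. *)
pose F (z : mx * mR) : \bar R :=
  (`|D ((z.2 : R) *: u + z.1)%R| `^ p * \1_(`[0%R, T]%classic) z.2)%:E.
have F0 z : 0 <= F z by rewrite lee_fin mulr_ge0 ?powR_ge0.
have mF : measurable_fun setT F.
  apply/measurable_EFinP; apply: measurable_funM; last first.
    by apply: measurableT_comp => //; exact: measurable_snd.
  apply: (measurableT_comp (measurable_powR p)).
  apply: measurableT_comp => //.
  by apply: (measurableT_comp mD); exact: measurable_line.
have FE x : \int[mu]_(t in `[0%R, T]) (`|D (t *: u + x)%R| `^ p)%:E =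
    \int[mu]_t F (x, t).
  rewrite integral_mkcond; apply: eq_integral => t _.
  by rewrite /F/= /patch indicE; case: ifPn => _; rewrite ?mulr1 ?mulr0.
pose J := \int[vol m n]_x (`|D x| `^ p)%:E.
have mJ : measurable_fun setT (fun x : mx => (`|D x| `^ p)%:E).
  apply/measurable_EFinP; apply: (measurableT_comp (measurable_powR p)).
  exact: measurableT_comp.
have J0 : 0 <= J by apply: integral_ge0 => x _; rewrite lee_fin powR_ge0.
have swap : \int[vol m n]_x \int[mu]_t F (x, t) = T%:E * J.
  rewrite (fubini_tonelli F)//.
  transitivity (\int[mu]_t (J * (\1_(`[0%R, T]%classic) t)%:E)).
    apply: eq_integral => t _.
    have Et : \int[vol m n]_x (`|D (t *: u + x)%R| `^ p)%:E = J.
      rewrite /J -(ge0_integral_vol_shift (t *: u)%R mJ); last first.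
        by move=> x; rewrite lee_fin powR_ge0.
      by apply: eq_integral => x _; rewrite addrC.
    rewrite -Et muleC -ge0_integralZl_EFin//; first last.
    - apply/measurable_EFinP; apply: (measurableT_comp (measurable_powR p)).
      apply: measurableT_comp => //; apply: continuous_measurable_mx => x.
      have h : {for x, continuous (fun y : mx => t *: u + y)%R}.
        by apply: continuousD; [exact: cst_continuous|move=> ?].
      exact: (continuous_comp h (cD _)).
    by apply: eq_integral => x _; rewrite [RHS]muleC -EFinM.
  rewrite ge0_integralZl//; last by apply/measurable_EFinP; exact: measurable_indic.
  by rewrite integral_indic// setIT muleC; congr (_ * _); exact: muI.
have main : \int[vol m n]_x (`|phi x| `^ p)%:E <= (T `^ p)%:E * J.
  apply: (@le_trans _ _ (\int[vol m n]_x
      ((T `^ (p - 1))%:E * \int[mu]_t F (x, t)))).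
    apply: le_integral_nonneg => x _; first by rewrite lee_fin powR_ge0.
    by rewrite -FE.
  rewrite ge0_integralZl ?lee_fin ?powR_ge0//; first last.
  - by move=> x _; exact: integral_ge0.
  - exact: measurable_fun_fubini_tonelli_F.
  by rewrite swap muleA -EFinM mulrC mulr_powRB1// ltW.
rewrite !Lnorm_EFinE; apply: le_trans.
  apply: (le_poweR _ _ main); first by rewrite invr_ge0 ltW.
  by apply: integral_ge0 => x _; rewrite lee_fin powR_ge0.
rewrite poweRM ?lee_fin ?powR_ge0// poweR_EFin -powRrM divff ?gt_eqF//.
by rewrite powRr1// ltW.
Qed.

End directional_poincare.

(** * Passage to the Sobolev space *)

Section sobolev_poincare.
Context {R : realType} {n : nat}.
Implicit Types (phi : 'cV[R]_n -> R) (u w : 'cV[R]_n) (Omega : set 'cV[R]_n).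

Lemma dot_cV u w : dot u w = \sum_i u i 0 * w i 0.
Proof. by apply: eq_bigr => i _; rewrite big_ord1. Qed.

Lemma le_enorm k l (w : 'M[R]_(k, l)) i j : `|w i j| <= enorm w.
Proof.
rewrite -sqrtr_sqr; apply: ler_wsqrtr.
rewrite /dot (bigD1 i)//= (bigD1 j)//= -expr2 -addrA lerDl addr_ge0//.
  by apply: sumr_ge0 => j' _; rewrite -expr2 sqr_ge0.
by apply: sumr_ge0 => i' _; apply: sumr_ge0 => j' _; rewrite -expr2 sqr_ge0.
Qed.

Lemma dot_le_enorm u w : `|dot u w| <= (\sum_i `|u i 0|) * enorm w.
Proof.
rewrite dot_cV (le_trans (ler_norm_sum _ _ _))// mulr_suml ler_sum// => i _.
by rewrite normrM ler_wpM2l// le_enorm.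
Qed.

Lemma cV_sum_delta u : u = \sum_i u i 0 *: delta_mx i 0.
Proof.
by rewrite [LHS]matrix_sum_delta; apply: eq_bigr => i _; rewrite big_ord1.
Qed.

Lemma dot_gradient u phi z :
  dot u (gradient phi z) = \sum_i u i 0 * partial i phi z.
Proof. by rewrite dot_cV; apply: eq_bigr => i _; rewrite mxE. Qed.

Lemma smooth_is_derive phi u z : smooth phi ->
  is_derive z u phi (dot u (gradient phi z)).
Proof.
move=> /(_ 1%N)[_ h]; rewrite dot_gradient {1}(cV_sum_delta u).
apply: (@is_derive_sum_directions _ _ _ _ _ _ (fun i => partial i phi)) => [i y|i].
  by apply: derivableP; exact: (h i).1.
exact: (h i).2.
Qed.

Lemma smooth_continuous_dot_gradient phi u : smooth phi ->
  continuous (fun z => dot u (gradient phi z)).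
Proof.
move=> /(_ 1%N)[_ h].
under eq_fun do rewrite dot_gradient.
apply: continuous_big => [|i _ z]; first exact: add_continuous.
have ci : continuous (partial i phi) := (h i).2.
by apply: cvgMl_tmp; [exact: (nbhs_filter z)|exact: ci].
Qed.

(** Moving by T u changes the i-th coordinate by more than the width 2 M of
    Omega, so z and z + T u cannot both lie in Omega, outside which phi
    vanishes. *)
Lemma test_function_poincare Omega phi u (i : 'I_n) (M T p : R) :
  1 <= p -> 0 < T -> (forall x, Omega x -> `|x i 0| <= M) ->
  M *+ 2 < T * `|u i 0| -> test_function Omega phi ->
  ('N[vol n 1]_p%:E[EFin \o phi] <=
   T%:E * 'N[vol n 1]_p%:E[EFin \o (fun z => dot u (gradient phi z))])%E.
Proof.
move=> p1 T0 OM MT [sphi _ phiO].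
apply: directional_poincare => //.
- exact: smooth_continuous_dot_gradient.
- by move=> z; exact: smooth_is_derive.
have supp z : phi z = 0 \/ Omega z.
  have [->|z0] := eqVneq (phi z) 0; first by left.
  by right; apply: phiO; exact: subset_closure.
move=> z; have [->|Oz] := supp z; first by left.
have [->|OTz] := supp (T *: u + z); first by right.
exfalso; have := OM _ OTz; have := OM _ Oz; rewrite !mxE => h1 h2.
have : `|T * u i 0| <= M *+ 2.
  rewrite -[T * u i 0](addrK (z i 0)) (le_trans (ler_normB _ _))// mulr2n.
  exact: lerD.
by rewrite normrM (gtr0_norm T0); apply/negP; rewrite -ltNge.
Qed.

Lemma measurable_dot d (S : measurableType d) u (g : S -> 'cV[R]_n) :
  measurable_fun setT g -> measurable_fun setT (fun z => dot u (g z)).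
Proof.
move=> mg; under eq_fun do rewrite dot_cV.
apply: measurable_sum => i; apply: measurable_funM; first exact: measurable_cst.
exact: (measurableT_comp (measurable_entry i 0) mg).
Qed.

Lemma dotB u w1 w2 : dot u (w1 - w2) = dot u w1 - dot u w2.
Proof.
by rewrite !dot_cV -sumrB; apply: eq_bigr => i _; rewrite !mxE mulrBr.
Qed.

(** Passage to the limit: replacing f and its gradient by a test function and
    its gradient costs at most (1 + T E) times the approximation error, where E
    is the sum of the |u i|. *)
Lemma sobolev_poincare Omega u (i : 'I_n) (M T p : R) (f : sobolev0 Omega p) :
  1 <= p -> 0 < T -> (forall x, Omega x -> `|x i 0| <= M) ->
  M *+ 2 < T * `|u i 0| ->
  ('N[vol n 1]_p%:E[EFin \o f] <=
   T%:E * 'N[vol n 1]_p%:E[EFin \o (fun z => dot u (sobolev_grad f z))])%E.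
Proof.
move=> p1 T0 OM MT; have p0 : 0 < p by exact: lt_le_trans p1.
have [phi [tphi cphi]] := sobolev_approx f.
set g := sobolev_grad f.
have mf : measurable_fun setT f := sobolev_fun_measurable f.
have mg : measurable_fun setT g := sobolev_grad_measurable f.
pose E : R := \sum_i `|u i 0|.
have E0 : 0 <= E by exact: sumr_ge0.
apply/lee_addgt0Pr => e e0.
(* Total cost of the approximation: 1 for phi k - f, T * E for the gradients. *)
pose K := 1 + T * E.
have K0 : 0 < K by rewrite ltr_wpDr// mulr_ge0// ltW.
have eK : 0 < e / K by rewrite divr_gt0.
have [k _ /(_ k (leqnn _))/=] := cphi _ (nbhs_open_ereal_lt (f := fun=> e / K) eK).
set a := Lnorm _ _ _; set b := Lnorm _ _ _ => abe.
have sphi : smooth (phi k) by have [] := tphi k.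
have mphi : measurable_fun setT (phi k).
  by apply: continuous_measurable_mx; exact: (sphi 0%N).
have mgrad : measurable_fun setT (gradient (phi k)).
  apply: measurable_fun_mx => i' j; under eq_fun do rewrite mxE.
  by apply: continuous_measurable_mx; exact: ((sphi 1%N).2 i').2.
have ph := test_function_poincare p1 T0 OM MT (tphi k).
pose G z := dot u (gradient (phi k) z).
pose H z := dot u (g z).
have mG : measurable_fun setT G by exact: measurable_dot.
have mH : measurable_fun setT H by exact: measurable_dot.
have f_phi : (Lnorm (vol n 1) p%:E (EFin \o f) <=
    b + Lnorm (vol n 1) p%:E (EFin \o phi k))%E.
  have -> : b = Lnorm (vol n 1) p%:E (EFin \o (fun z => f z - phi k z)).
    by rewrite /b -oppe_Lnorm; apply: eq_Lnorm => z /=; rewrite opprB.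
  rewrite (_ : EFin \o f = EFin \o ((fun z => f z - phi k z) \+ phi k)); last first.
    by apply/funext => z /=; rewrite subrK.
  by apply: minkowski_EFin => //; exact: measurable_funB.
have G_H : (Lnorm (vol n 1) p%:E (EFin \o G) <=
    E%:E * a + Lnorm (vol n 1) p%:E (EFin \o H))%E.
  rewrite (_ : EFin \o G = EFin \o ((fun z => G z - H z) \+ H)); last first.
    by apply/funext => z /=; rewrite subrK.
  apply: le_trans; first by apply: minkowski_EFin => //; exact: measurable_funB.
  rewrite leeD2r// -LnormZ//; last first.
    apply: (measurableT_comp (@measurable_enorm R n 1)).
    apply: measurable_fun_mx => i' j.
    rewrite (_ : (fun z => _) =
        (fun z => gradient (phi k) z i' j - g z i' j)); last first.
      by apply/funext => z; rewrite !mxE.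
    apply: measurable_funB.
      exact: (measurableT_comp (measurable_entry i' j) mgrad).
    exact: (measurableT_comp (measurable_entry i' j) mg).
  apply: le_Lnorm => // z; rewrite -dotB (le_trans (dot_le_enorm _ _))//.
  exact: ler_norm.
have a0 : (0 <= a)%E by exact: Lnorm_ge0.
have b0 : (0 <= b)%E by exact: Lnorm_ge0.
apply: le_trans f_phi _; apply: le_trans (leeD2l b ph) _.
apply: (@le_trans _ _ (b + T%:E * (E%:E * a + Lnorm (vol n 1) p%:E (EFin \o H))))%E.
  by rewrite leeD2l// lee_pmul2l.
rewrite ge0_muleDr ?mule_ge0 ?lee_fin ?Lnorm_ge0//.
rewrite addeA addeC leeD2l//.
apply: (@le_trans _ _ (K%:E * (b + a)))%E; last first.
  have -> : (e%:E = K%:E * (e / K)%:E)%E by rewrite -EFinM mulrC divfK ?gt_eqF.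
  by rewrite addeC; apply: lee_wpmul2l; rewrite ?lee_fin ltW.
rewrite ge0_muleDr// leeD//.
  by rewrite -{1}(mul1e b) lee_wpmul2r// lee_fin lerDl mulr_ge0// ltW.
by rewrite muleA -EFinM lee_wpmul2r// lee_fin lerDr.
Qed.

End sobolev_poincare.

(** * Convex bodies, balls and cubes *)

Section euclidean_geometry.
Context {R : realType} {m n : nat}.
Local Notation mx := 'M[R]_(m, n).
Implicit Types (x y : mx) (K : set mx).

Lemma dot_le_sum x y : `|dot x y| <= \sum_i \sum_j `|x i j| * `|y i j|.
Proof.
apply: le_trans (ler_norm_sum _ _ _) _; apply: ler_sum => i _.
apply: le_trans (ler_norm_sum _ _ _) _; apply: ler_sum => j _.
by rewrite normrM.
Qed.

(** Through this bound small cubes lie in the unit ball and in the polar of any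
    bounded set, which gives both of them positive volume. *)
Lemma dot_le_cube (a b : R) x y : cube a x -> cube b y ->
  dot x y <= (m * n)%:R * (a * b).
Proof.
move=> xa yb; rewrite (le_trans (ler_norm _))// (le_trans (dot_le_sum _ _))//.
apply: (@le_trans _ _ (\sum_(i < m) \sum_(j < n) a * b)).
  by apply: ler_sum => i _; apply: ler_sum => j _; apply: ler_pM.
by rewrite !big_const_ord !iter_addr_0 -mulrnA mulr_natl mulnC.
Qed.

Lemma dot_continuous x : continuous (dot x : mx -> R).
Proof.
apply: continuous_big => [|i _]; first exact: add_continuous.
apply: continuous_big => [|j _ y]; first exact: add_continuous.
by apply: cvgMl_tmp; [exact: (nbhs_filter y)|exact: coord_continuous].
Qed.

(** A polar is an intersection of closed half-spaces. *)
Lemma measurable_polar K : measurable (polar K).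
Proof.
rewrite -[X in measurable X]setCK; apply: measurableC; apply: open_measurable_mx.
rewrite openC (_ : polar K = \bigcap_(x in K) (dot x @^-1` [set t | t <= 1])).
  apply: closed_bigI => x _; apply: closed_comp; last exact: closed_le.
  by move=> y _; exact: dot_continuous.
by apply/seteqP; split.
Qed.

Lemma cube_sub_eball : (0 < m * n)%N -> @cube R m n (m * n)%:R^-1 `<=` eball m n.
Proof.
move=> mn0 x xc; rewrite /eball/= -[leRHS]sqrtr1; apply: ler_wsqrtr.
apply: le_trans (dot_le_cube xc xc) _.
have N1 : 1 <= (m * n)%:R :> R by rewrite ler1n.
by rewrite mulrA divff ?mul1r ?invf_le1 ?gt_eqF ?(lt_le_trans ltr01).
Qed.

Lemma eball_sub_cube : @eball R m n `<=` cube (1 : R).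
Proof. by move=> x x1 i j; rewrite (le_trans (le_enorm _ _ _)). Qed.

Lemma vol_cube_gt0 (r : R) : 0 < r -> (0 < vol m n (cube r))%E.
Proof. by move=> r0; rewrite vol_cube// lte_fin exprn_gt0// mulrn_wgt0. Qed.

Lemma vol_eball_gt0 : (0 < m * n)%N -> (0 < vol m n (@eball R m n))%E.
Proof.
move=> mn0; have r0 : 0 < (m * n)%:R^-1 :> R by rewrite invr_gt0 ltr0n.
apply: lt_le_trans (vol_cube_gt0 r0) _; apply: le_measure; rewrite ?inE.
- exact: measurable_cube.
- exact: measurable_eball.
- exact: cube_sub_eball.
Qed.

Lemma vol_eball_lty : (vol m n (@eball R m n) < +oo)%E.
Proof.
apply: (@le_lt_trans _ _ (vol m n (cube 1))).
  apply: le_measure; rewrite ?inE.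
  - exact: measurable_eball.
  - exact: measurable_cube.
  - exact: eball_sub_cube.
by rewrite vol_cube// ltry.
Qed.

(** The area of the sphere is by definition a multiple of the volume of the
    ball, which lies in a cube. *)
Lemma surfaceT_lty : (surface m n [set: mx] < +oo :> \bar R)%E.
Proof.
rewrite /surface /pushforward preimage_setT /mscale/= /mrestr setTI.
by rewrite lte_mul_pinfty ?lee_fin// ?vol_eball_lty.
Qed.

Lemma integral_surface_le (D : set mx) (f : mx -> \bar R) (c : \bar R) :
  (forall x, D x -> 0 <= f x)%E -> (forall x, D x -> f x <= c)%E -> (0 <= c)%E ->
  (\int[surface m n]_(x in D) f x <= c * surface m n [set: mx])%E.
Proof.
move=> f0 fc c0; rewrite -integral_cst// [leLHS]integral_mkcond.
apply: le_integral_nonneg => x _; rewrite /patch; case: ifPn => // /set_mem Dx;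
  [exact: f0|exact: fc].
Qed.

Lemma vol_polar_gt0 K (P : R) : (0 < m * n)%N -> 0 < P -> K `<=` cube P ->
  (0 < vol m n (polar K))%E.
Proof.
move=> mn0 P0 KP; have N0 : 0 < (m * n)%:R :> R by rewrite ltr0n.
have r0 : 0 < ((m * n)%:R * P)^-1 by rewrite invr_gt0 mulr_gt0.
apply: lt_le_trans (vol_cube_gt0 r0) _; apply: le_measure; rewrite ?inE.
- exact: measurable_cube.
- exact: measurable_polar.
- move=> y yc x Kx; apply: le_trans (dot_le_cube (KP _ Kx) yc) _.
  by rewrite mulrA divff// mulf_neq0 ?gt_eqF.
Qed.

End euclidean_geometry.

Section support_function.
Context {R : realType} {m : nat}.
Implicit Types (Q : set 'rV[R]_m) (w : 'rV[R]_m).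

Lemma bounded_sub_cube k l (A : set 'M[R]_(k, l)) : bounded_set A ->
  exists2 B : R, 0 < B & A `<=` cube B.
Proof.
move=> /ex_strict_bound_gt0[B B0 AB]; exists B => // y Ay i j.
apply: le_trans (ltW (AB y Ay)); rewrite -[leRHS]/(mx_norm _) mx_normrE.
exact: (le_bigmax _ (fun k => `|y k.1 k.2|) (i, j)).
Qed.

Lemma compact_sub_cube Q : compact Q -> exists2 B : R, 0 < B & Q `<=` cube B.
Proof.
by move=> /compact_bounded; exact: bounded_sub_cube.
Qed.

Lemma interior_cube Q : Q° 0 -> exists2 r : R, 0 < r & cube r `<=` Q.
Proof.
move=> /nbhs_ballP[e /= e0 eQ]; exists (e / 2); first by rewrite divr_gt0.
move=> y ye; apply: eQ; apply/mx_ballP => // i j; rewrite mxE sub0r normrN.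
by rewrite (le_lt_trans (ye i j))//; lra.
Qed.

Lemma support_fun_le Q (B : R) w : Q !=set0 -> Q `<=` cube B ->
  support_fun Q w <= B * \sum_j `|w 0 j|.
Proof.
move=> [y0 Qy0] QB; apply: ge_sup; first by exists (dot y0 w), y0.
move=> _ [y Qy <-]; rewrite (le_trans (ler_norm _))// (le_trans (dot_le_sum _ _))//.
rewrite big_ord1 mulr_sumr ler_sum// => j _.
by apply: ler_wpM2r => //; exact: QB.
Qed.

(** Q contains the points +r e_j and -r e_j; the boundedness of Q is what makes
    the supremum an upper bound of their scalar products with w. *)
Lemma le_support_fun Q (B r : R) w j : Q `<=` cube B -> 0 < r -> cube r `<=` Q ->
  r * `|w 0 j| <= support_fun Q w.
Proof.
move=> QB r0 rQ.
(* The vertex of r e_j, -r e_j on the side of w. *)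
pose y : 'rV[R]_m := (r * Num.sg (w 0 j)) *: delta_mx 0 j.
have Qy : Q y.
  apply: rQ => i k; rewrite !mxE; case: (_ && _); last by rewrite mulr0 normr0 ltW.
  by rewrite mulr1 normrM gtr0_norm// normr_sg ger_pMr// lern1 leq_b1.
have <- : dot y w = r * `|w 0 j|.
  rewrite /dot big_ord1 (bigD1 j)//= big1 ?addr0 => [|k kj]; last first.
    by rewrite !mxE (negbTE kj) andbF mulr0 mul0r.
  by rewrite !mxE !eqxx mulr1 -mulrA -normrEsg.
apply: ub_le_sup; last by exists y.
exists (B * \sum_j `|w 0 j|) => _ [z Qz <-].
rewrite (le_trans (ler_norm _))// (le_trans (dot_le_sum _ _))//.
rewrite big_ord1 mulr_sumr ler_sum// => k _.
by apply: ler_wpM2r => //; exact: QB.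
Qed.

End support_function.

(** * Positivity of the constant of the energy *)

Section projection_constant.
Context {R : realType} {n m : nat}.
Variables (Q : set 'rV[R]_m) (p B r : R).
Hypotheses (p1 : 1 <= p) (QB : Q `<=` cube B) (r0 : 0 < r) (rQ : cube r `<=` Q).

Lemma support_fun_ge0 (w : 'rV[R]_m) : (0 < m)%N -> 0 <= support_fun Q w.
Proof.
move=> m0; apply: le_trans (le_support_fun w (Ordinal m0) QB r0 rQ).
by rewrite mulr_ge0// ltW.
Qed.

Lemma dot_scale_delta (x : 'M[R]_(n, m)) i j (s : R) :
  dot x (s *: delta_mx i j) = s * x i j.
Proof.
rewrite /dot (bigD1 i)//= [X in _ + X]big1 ?addr0 => [|i' ii']; last first.
  by apply: big1 => j' _; rewrite !mxE (negbTE ii') !mulr0.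
rewrite (bigD1 j)//= [X in _ + X]big1 ?addr0 => [|j' jj']; last first.
  by rewrite !mxE (negbTE jj') andbF !mulr0.
by rewrite !mxE !eqxx mulr1 mulrC.
Qed.

(** The support function of the projection body at +e_ij and -e_ij bounds the
    entries of its points.  It is finite there, because the integrand is at most
    B^p on the sphere, whose area is finite. *)
Lemma proj_body_sub_cube : (0 < m)%N -> 0 <= B ->
  exists2 P : R, 0 < P & @proj_body R n m Q p `<=` cube P.
Proof.
move=> m0 B0; have p0 : 0 < p by exact: lt_le_trans p1.
have Q0 : Q !=set0 by exists 0; apply: rQ => i j; rewrite mxE normr0 ltW.
pose S : \bar R := surface n 1 [set: 'cV[R]_n].
have S0 : (0 <= S)%E by exact: measure_ge0.
pose P0 := (((B `^ p)%:E * S) `^ p^-1)%E.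
have P0fin : P0 \is a fin_num.
  rewrite ge0_fin_numE ?poweR_ge0// poweR_lty//.
  by rewrite lte_mul_pinfty ?lee_fin ?powR_ge0//; exact: surfaceT_lty.
have proj_le (s : R) i j : `|s| <= 1 ->
    (proj_support Q p (s *: delta_mx i j : 'M[R]_(n, m)) <= P0)%E.
  move=> s1; apply: le_poweR; first by rewrite invr_ge0 ltW.
    by apply: integral_ge0 => v _; rewrite lee_fin powR_ge0.
  apply: integral_surface_le => [v _|v v1|]; rewrite lee_fin; try exact: powR_ge0.
  apply: ge0_ler_powR; rewrite ?nnegrE ?support_fun_ge0//; first exact: ltW.
  apply: le_trans (support_fun_le _ Q0 QB) _; rewrite -[leRHS]mulr1 ler_wpM2l//.
  rewrite (bigD1 j)//= big1 ?addr0 => [|k kj]; last first.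
    rewrite mxE big1 ?normr0// => l _.
    by rewrite !mxE (negbTE kj) andbF !mulr0.
  rewrite mxE (bigD1 i)//= big1 ?addr0 => [|l li]; last first.
    by rewrite !mxE (negbTE li) !mulr0.
  rewrite !mxE !eqxx mulr1 normrM mulr_ile1//.
  by rewrite (le_trans (le_enorm _ _ _))// v1.
exists (fine P0 + 1); first by rewrite ltr_wpDl// fine_ge0// poweR_ge0.
move=> x Kx i j; rewrite -lee_fin EFinD fineK//.
apply: (@le_trans _ _ P0); last by rewrite leeDl.
have [s [s1 <-]] : exists s : R, `|s| <= 1 /\ s * x i j = `|x i j|.
  by exists (Num.sg (x i j)); rewrite normr_sg lern1 leq_b1 -normrEsg.
by rewrite -dot_scale_delta; apply: le_trans (Kx _) (proj_le _ _ _ _).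
Qed.

Lemma dconst_gt0 : (0 < n)%N -> (0 < m)%N -> 0 <= B -> (0 < dconst n Q p)%E.
Proof.
move=> n0 m0 B0; have nm0 : (0 < n * m)%N by rewrite muln_gt0 n0.
have [P P0 KP] := proj_body_sub_cube m0 B0.
rewrite /dconst mule_gt0// poweR_gt0// mule_gt0//; rewrite ?lte_fin ?ltr0n//.
- by apply: vol_eball_gt0; rewrite muln1.
- exact: vol_polar_gt0 KP.
Qed.

End projection_constant.

Section inverse_power.
Local Open Scope ereal_scope.
Context {R : realType}.

Lemma inve_anti (x y : \bar R) : 0 <= x -> x <= y -> y^-1 <= x^-1.
Proof.
move=> x0 xy; have y0 : 0 <= y by exact: le_trans xy.
by rewrite inve_ple ?inE ?inve_ge0// inveK.
Qed.

(** The outer operations of the energy applied to the constant A^N in place of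
    the inner integrals, with s the area of the sphere: the result is A up to the
    factor s^(-1/N).  The conventions 0^-1 = +oo and +oo^-1 = 0 make it hold for
    A = 0 and A = +oo as well. *)
Lemma inve_root_le (A : \bar R) (s N : R) : 0 <= A -> (0 < s)%R -> (0 < N)%R ->
  ((s `^ N^-1)^-1)%:E * A <= (((A `^ N)^-1 * s%:E) `^ N^-1)^-1.
Proof.
move=> A0 s0 N0; have N1 : (0 < N^-1)%R by rewrite invr_gt0.
case: A A0 => [a|_|//].
  rewrite lee_fin le_eqVlt => /predU1P[<-|a0].
    rewrite mule0 inve_ge0; exact: poweR_ge0.
  rewrite poweR_EFin inver gt_eqF ?powR_gt0//= inver.
  rewrite gt_eqF ?powR_gt0 ?mulr_gt0 ?invr_gt0 ?powR_gt0//.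
  rewrite -EFinM lee_fin powRM ?invr_ge0 ?powR_ge0 ?(ltW s0)//.
  rewrite -(powR_inv1 (powR_ge0 a N)) -!powRrM.
  rewrite (_ : (N * (-1 * N^-1) = -1)%R); last by rewrite mulN1r mulrN divff ?gt_eqF.
  by rewrite (powR_inv1 (ltW a0)) invfM invrK mulrC.
rewrite poweRyr ?gt_eqF// invey mul0e poweR0r ?gt_eqF// inve0.
exact: leey.
Qed.

End inverse_power.

(** * Lower bound of the energy *)

Section energy_lower_bound.
Context {R : realType} {n m : nat}.
Hypotheses (n0 : (0 < n)%N) (m0 : (0 < m)%N).

(** If every entry were at most 1/(2N) with N = n m, the squared length would be
    at most N / (2N)^2 < 1. *)
Lemma esphere_large_entry (theta : 'M[R]_(n, m)) : esphere n m theta ->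
  exists i j, ((n * m)%:R *+ 2)^-1 < `|theta i j|.
Proof.
have N1 : 1 <= (n * m)%:R :> R by rewrite ler1n muln_gt0 n0.
rewrite /esphere/= => th1; apply/not_existsP => /= h.
have : dot theta theta = 1.
  have dd0 : 0 <= dot theta theta.
    by apply: sumr_ge0 => i _; apply: sumr_ge0 => j _; rewrite -expr2 sqr_ge0.
  by rewrite -(sqr_sqrtr dd0) -/(enorm theta) th1 expr1n.
have cth : cube ((n * m)%:R *+ 2)^-1 theta.
  by move=> i j; rewrite leNgt; apply/negP => hij; apply: (h i); exists j.
apply/eqP; rewrite lt_eqF// (le_lt_trans (dot_le_cube cth cth))//.
set N := (n * m)%:R in N1 *.
have Ni : N * N^-1 = 1 by rewrite divff// gt_eqF// (lt_le_trans ltr01).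
have Nl : N^-1 <= 1 by rewrite invf_le1// (lt_le_trans ltr01).
have -> : (N *+ 2)^-1 = N^-1 / 2 by rewrite -mulr_natr invfM.
by rewrite mulrACA !mulrA Ni mul1r; lra.
Qed.

(** With j the column of a large entry of theta, the j-th coordinate of
    (grad f)^t theta is the derivative of f in the direction of that column.  The
    exit time T is 2 M times the inverse 2 n m of the lower bound for the large
    entry. *)
Lemma directional_energy_ge (Omega : set 'cV[R]_n) (Q : set 'rV[R]_m)
    (p M B r : R) (f : sobolev0 Omega p) (theta : 'M[R]_(n, m)) :
  1 <= p -> 0 < M -> Omega `<=` cube M ->
  Q `<=` cube B -> 0 < r -> cube r `<=` Q -> esphere n m theta ->
  (((r / (M *+ 2 * ((n * m)%:R *+ 2)))%:E * 'N[vol n 1]_p%:E[EFin \o f]) `^ p <=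
  \int[vol n 1]_z (support_fun Q ((sobolev_grad f z)^T *m theta) `^ p)%:E)%E.
Proof.
move=> p1 M0 OM QB r0 rQ /esphere_large_entry[i [j thij]].
have p0 : 0 < p by exact: lt_le_trans p1.
have N0 : 0 < (n * m)%:R *+ 2 :> R by rewrite mulrn_wgt0// ltr0n muln_gt0 n0.
set T := M *+ 2 * _; have T0 : 0 < T by rewrite mulr_gt0// mulrn_wgt0.
pose u := col j theta.
have MT : M *+ 2 < T * `|u i 0|.
  rewrite -mulrA -[ltLHS]mulr1 ltr_pM2l ?mulrn_wgt0// mxE.
  by rewrite -ltr_pdivrMl// mulr1.
have := sobolev_poincare f p1 T0 (fun x Ox => OM x Ox i 0) MT.
pose h z := dot u (sobolev_grad f z).
have mh : measurable_fun setT h.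
  by apply: measurable_dot; exact: sobolev_grad_measurable.
rewrite -/h => fh.
pose g z := r * h z.
apply: (@le_trans _ _ ('N[vol n 1]_p%:E[EFin \o g] `^ p)%E).
  apply: le_poweR; first exact: ltW.
    apply: mule_ge0; last exact: Lnorm_ge0.
    by rewrite lee_fin; apply: divr_ge0; exact: ltW.
  rewrite LnormZ ?(ltW r0)//.
  rewrite EFinM -muleA lee_pmul2l// muleC.
  by rewrite lee_pdivrMr// muleC.
rewrite poweR_Lnorm_EFin//; apply: le_integral_nonneg => z _.
  by rewrite lee_fin powR_ge0.
rewrite lee_fin.
have hE : h z = ((sobolev_grad f z)^T *m theta) 0 j.
  by rewrite /h dot_cV mxE; apply: eq_bigr => k _; rewrite !mxE mulrC.
apply: ge0_ler_powR; rewrite ?nnegrE//; first exact: ltW.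
  exact: support_fun_ge0 QB r0 rQ _ m0.
rewrite normrM (gtr0_norm r0) hE; exact: le_support_fun QB r0 rQ.
Qed.

Lemma Lnorm_ae0 (p : R) (f : 'cV[R]_n -> R) : 0 < p -> measurable_fun setT f ->
  {ae vol n 1, forall z, f z = 0} -> ('N[vol n 1]_p%:E[EFin \o f] = 0)%E.
Proof.
move=> p0 mf f0; rewrite Lnorm_EFinE.
rewrite (ae_eq_integral (cst 0%E))//.
- by rewrite integral0 poweR0r// invr_neq0// gt_eqF.
- apply/measurable_EFinP; apply: (measurableT_comp (measurable_powR p)).
  exact: measurableT_comp.
- by apply: filterS f0 => z /= -> _; rewrite normr0 powR0// gt_eqF.
Qed.

End energy_lower_bound.

Theorem theorem1p4 (R : realType) (n m : nat) (Omega : set 'cV[R]_n)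
    (Q : set 'rV[R]_m) (p : R) :
  (0 < n)%N -> (0 < m)%N ->
  open Omega -> connected Omega -> bounded_set Omega -> Omega° 0 ->
  convex_body Q -> origin_symmetric Q -> Q° 0 ->
  1 <= p ->
  exists C : R, 0 < C /\
    forall f : sobolev0 Omega p,
      (C%:E * 'N[vol n 1]_p%:E [EFin \o f] <= energy Q f)%E.
Proof.
move=> n0 m0 _ _ /bounded_sub_cube[M M0 OM] _ [/compact_sub_cube[B B0 QB] _ _] _.
move=> /interior_cube[r r0 rQ] p1.
have p0 : 0 < p by exact: lt_le_trans p1.
(* A real lower bound of dconst, since C has to be real. *)
have [d0 [d0_gt0 d0_le]] : exists d0 : R, 0 < d0 /\ (d0%:E <= dconst n Q p)%E.
  have := dconst_gt0 p1 QB r0 rQ n0 m0 (ltW B0).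
  case: (dconst n Q p) => [d|_|//]; first by rewrite lte_fin => ?; exists d.
  by exists 1; split; rewrite ?leey.
have [s [s0 sS]] : exists s : R,
    0 < s /\ (surface n m [set: 'M[R]_(n, m)] <= s%:E)%E.
  have Sge0 : (0 <= surface n m [set: 'M[R]_(n, m)])%E by exact: measure_ge0.
  have Sfin : surface n m [set: 'M[R]_(n, m)] \is a fin_num.
    by rewrite ge0_fin_numE// surfaceT_lty.
  exists (fine (surface n m [set: 'M[R]_(n, m)]) + 1).
  by rewrite EFinD fineK// leeDl// ltr_wpDl// fine_ge0.
have N0 : 0 < (n * m)%:R :> R by rewrite ltr0n muln_gt0 n0.
set N : R := (n * m)%:R.
pose c := r / (M *+ 2 * (N *+ 2)).
have c0 : 0 < c by rewrite divr_gt0// mulr_gt0// mulrn_wgt0.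
pose S := s `^ N^-1.
have S0 : 0 < S by exact: powR_gt0.
exists (d0 * (S^-1 * c)); split; first by rewrite mulr_gt0// mulr_gt0// invr_gt0.
move=> f; rewrite /energy; case: asboolP => [f_ae0|_].
  by rewrite Lnorm_ae0// ?mule0//; exact: sobolev_fun_measurable.
set A := Lnorm _ _ _; have A0 : (0 <= A)%E by exact: Lnorm_ge0.
rewrite EFinM -muleA; apply: lee_pmul => //.
- by rewrite lee_fin ltW.
- by apply: mule_ge0 => //; rewrite lee_fin mulr_ge0 ?invr_ge0 ?(ltW S0) ?(ltW c0).
have cA0 : (0 <= c%:E * A)%E by apply: mule_ge0 => //; rewrite lee_fin ltW.
rewrite EFinM -muleA.
apply: le_trans (inve_root_le cA0 s0 N0) _.
apply: inve_anti; first exact: poweR_ge0.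
apply: le_poweR; first by rewrite invr_ge0 ltW.
  by apply: integral_ge0 => theta _; rewrite inve_ge0 poweR_ge0.
apply: le_trans (lee_wpmul2l _ sS); last by rewrite inve_ge0 poweR_ge0.
apply: integral_surface_le => [theta _|theta th1|]; rewrite ?inve_ge0 ?poweR_ge0//.
apply: inve_anti; first exact: poweR_ge0.
have -> : ((c%:E * A) `^ N = ((c%:E * A) `^ p) `^ (N / p))%E.
  by rewrite -poweRrM mulrCA divff ?mulr1// gt_eqF.
apply: le_poweR; first by rewrite divr_ge0// ltW.
  exact: poweR_ge0.
exact: (directional_energy_ge n0 m0 f p1 M0 OM QB r0 rQ th1).
Qed.
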